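(* For $n\ge4$ let $X^{(n)}$ be a random variable with values in $\{1,\dots,n+1\}$ and $\mathbb P(X^{(n)}=j)=\mathcal T^{(1)}_{n,j}$ for $1\le j\le n+1$, and let $Z^{(n)}=n-X^{(n)}$. Then $Z^{(n)}$ converges in distribution, as $n\to\infty$, to a random variable $Z$ supported on the non-negative integers with probability mass function $$\mathbb P(Z=z)=\frac{5+3z}{2^{z+4}},\qquad z=0,1,2,\dots,$$ and $\mathbb E[Z]=\frac74$, $\mathbb E[Z^2]=\frac{27}{4}$, $\operatorname{Var}[Z]=\frac{59}{16}$.
   Context: Define $\psi:\{1,2,3,\dots\}\to\{0,1,2,\dots\}$ by $\psi(1)=0$, $\psi(2)=1$, $\psi(3)=2$ and $\psi(j)=\sum_{k=1}^{j-1}\psi(k)$ for $j\ge 4$. The triangular array $\mathcal T=(\mathcal T_{n,j})$, $n\ge 0$, $1\le j\le n+1$, of integers is defined recursively by: $\mathcal T_{n,n+1}=1$ for every $n\ge 0$; $\mathcal T_{1,1}=1$, $\mathcal T_{2,2}=2$, $\mathcal T_{3,3}=3$; $\mathcal T_{n,n}=\sum_{k=1}^{n-2}\mathcal T_{n-k,n-k}$ for every $n\ge 4$; and $\mathcal T_{n,j}=\mathcal T_{n-1,j}+\psi(j)$ for every $n\ge 2$ and $1\le j\le n-1$. The normalised array is $\mathcal T^{(1)}_{n,j}=2^{-n}\mathcal T_{n,j}$; each of its rows is a probability mass function. *)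

(* Defs.v *)
From HB Require Import structures.
From mathcomp Require Import all_boot all_order all_algebra.
From mathcomp Require Import all_classical all_reals all_analysis.

Set Implicit Arguments.
Unset Strict Implicit.
Unset Printing Implicit Defensive.

Import Order.TTheory GRing.Theory Num.Theory.
Import numFieldNormedType.Exports.

Local Open Scope classical_set_scope.
Local Open Scope ring_scope.

(* [psi] and the diagonal of [T] are course-of-values recursions: [psi_seq m]
   and [diag_seq m] list the values at 1, ..., m.  The defining recurrences
   are recovered as [psi_rec] and [T_diag_rec]. *)
Definition psi_next (s : seq nat) : nat :=
  match size s with
  | 0 => 0
  | 1 => 1
  | 2 => 2
  | m => \sum_(1 <= k < m.+1) nth 0 s k.-1
  end%N.

Fixpoint psi_seq (m : nat) : seq nat :=
  if m is m'.+1 then rcons (psi_seq m') (psi_next (psi_seq m')) else [::].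

(* Meaningful for [1 <= j]; [psi 0] is a dummy value. *)
Definition psi (j : nat) : nat := nth 0%N (psi_seq j) j.-1.

Definition diag_next (s : seq int) : int :=
  match size s with
  | 0 => 1
  | 1 => 2
  | 2 => 3
  | m => \sum_(1 <= k < m) nth 0 s (m.+1 - k).-1
  end.

Fixpoint diag_seq (m : nat) : seq int :=
  if m is m'.+1 then rcons (diag_seq m') (diag_next (diag_seq m')) else [::].

(* Meaningful for [1 <= j <= n.+1]; other entries are dummy values. *)
Fixpoint T (n j : nat) : int :=
  if j == n.+1 then 1
  else if j == n then nth 0 (diag_seq n) n.-1
  else if n is n'.+1 then T n' j + (psi j)%:Z else 0.

Lemma size_psi_seq m : size (psi_seq m) = m.
Proof. by elim: m => //= m IH; rewrite size_rcons IH. Qed.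

Lemma nth_psi_seq m k : (0 < k <= m)%N -> nth 0%N (psi_seq m) k.-1 = psi k.
Proof.
move=> /andP[k0]; elim: m => [|m IH]; first by case: k k0.
rewrite leq_eqVlt => /orP[/eqP -> //|km].
rewrite /= nth_rcons size_psi_seq.
by case: k k0 km IH => //= k _ km -> //; rewrite -ltnS km.
Qed.

Lemma psi1 : psi 1 = 0%N. Proof. by []. Qed.
Lemma psi2 : psi 2 = 1%N. Proof. by []. Qed.
Lemma psi3 : psi 3 = 2%N. Proof. by []. Qed.

Lemma psi_rec j : (4 <= j)%N -> psi j = (\sum_(1 <= k < j) psi k)%N.
Proof.
case: j => [|j] // j3.
rewrite [LHS]/psi [psi_seq _]/= nth_rcons size_psi_seq ltnn eqxx /psi_next.
rewrite size_psi_seq; case: j j3 => [|[|[|j]]] // _.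
by apply: eq_big_nat => k /andP[k0 kj]; rewrite nth_psi_seq // k0 -ltnS.
Qed.

Lemma size_diag_seq m : size (diag_seq m) = m.
Proof. by elim: m => //= m IH; rewrite size_rcons IH. Qed.

Lemma T_last n : T n n.+1 = 1.
Proof. by case: n => [|n] //=; rewrite eqxx. Qed.

Lemma T_diag n : T n n = nth 0 (diag_seq n) n.-1.
Proof. by case: n => [|n] //; rewrite /T -/T ltn_eqF // eqxx. Qed.

Lemma nth_diag_seq m k : (0 < k <= m)%N -> nth 0 (diag_seq m) k.-1 = T k k.
Proof.
rewrite T_diag => /andP[k0]; elim: m => [|m IH]; first by case: k k0.
rewrite leq_eqVlt => /orP[/eqP -> //|km].
rewrite /= nth_rcons size_diag_seq.
by case: k k0 km IH => //= k _ km -> //; rewrite -ltnS km.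
Qed.

Lemma T11 : T 1 1 = 1. Proof. by []. Qed.
Lemma T22 : T 2 2 = 2. Proof. by []. Qed.
Lemma T33 : T 3 3 = 3. Proof. by []. Qed.

Lemma T_diag_rec n : (4 <= n)%N ->
  T n n = \sum_(1 <= k < n.-1) T (n - k) (n - k).
Proof.
case: n => [|n] // n3.
rewrite T_diag [diag_seq _]/= nth_rcons size_diag_seq ltnn eqxx /diag_next.
rewrite size_diag_seq; case: n n3 => [|[|[|n]]] // _.
apply: eq_big_nat => k /andP[k0 kn]; rewrite nth_diag_seq // subn_gt0.
by rewrite (ltn_trans kn) //= -[n.+3]/(n.+4 - 1)%N leq_sub2l.
Qed.

Lemma T_rec n j : (2 <= n)%N -> (1 <= j <= n.-1)%N ->
  T n j = T n.-1 j + (psi j)%:Z.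
Proof.
case: n => [|n] //= _ /andP[_ jn].
by rewrite !ltn_eqF // ltnS // leqW.
Qed.

Definition normT (R : realType) (n j : nat) : R := 2 ^- n * (T n j)%:~R.

Definition Zrv (R : realType) (d : measure_display) (Omega : measurableType d)
    (P : probability Omega R) (n : nat) (X : {RV P >-> R}) : Omega -> R :=
  fun omega => n%:R - X omega.

Lemma measurable_Zrv (R : realType) (d : measure_display)
    (Omega : measurableType d) (P : probability Omega R) (n : nat)
    (X : {RV P >-> R}) : measurable_fun setT (Zrv n X).
Proof. exact: measurable_realfun.measurable_funB. Qed.

HB.instance Definition _ (R : realType) (d : measure_display)
    (Omega : measurableType d) (P : probability Omega R) (n : nat)
    (X : {RV P >-> R}) :=
  isMeasurableFun.Build _ _ Omega R (Zrv n X) (measurable_Zrv n X).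

(* The [Y n] need not live on a common probability space. *)
Definition cvg_in_distribution (R : realType)
    (d : nat -> measure_display) (Omega : forall n, measurableType (d n))
    (P : forall n, probability (Omega n) R) (Y : forall n, {RV (P n) >-> R})
    (d' : measure_display) (Omega' : measurableType d')
    (P' : probability Omega' R) (Z : {RV P' >-> R}) : Prop :=
  forall x : R, {for x, continuous (cdf Z)} ->
    cdf (Y n) x @[n --> \oo] --> cdf Z x.

(* Main.v *)
Require Import Defs.
From HB Require Import structures.
From mathcomp Require Import all_boot all_order all_algebra.
From mathcomp Require Import all_classical all_reals all_analysis.
From mathcomp Require Import ring zify.

Import Order.TTheory GRing.Theory Num.Theory.
Import numFieldNormedType.Exports.

Local Open Scope classical_set_scope.
Local Open Scope ring_scope.

(** The recurrences have closed forms from the fourth index on: a value that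
    is the sum of the earlier ones doubles at each step, so that [psi j = 3 * 2 ^ (j - 4)]
    and [T j j = 5 * 2 ^ (j - 4)], while going down a column adds [psi j] at
    each row.  Hence [T n (n - z) = (5 + 3 z) * 2 ^ (n - z - 4)] as soon as
    [z + 4 <= n], and then [P (Z n = z)] is not merely close but equal to its
    limit [(5 + 3 z) / 2 ^ (z + 4)] (lemma [normT_limit]).

    A given real [x] has only finitely many natural numbers below it.  For
    large [n] the distribution function of [Z n] at [x] therefore differs from
    the limiting one at most by the mass [2 ^ - n] that [Z n] gives to [-1]
    (lemma [cdf_Zrv_bounds]), and this mass vanishes.

    The total mass and the moments of the limit are sums of
    [limit_pmf z * f z] with [f] polynomial.  Each one telescopes, as the
    summand can be written [q(z) / 2 ^ z - q(z + 1) / 2 ^ (z + 1)] for a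
    polynomial [q], so that the sum is [q(0)] (lemma [integral_limit_law]).
    The coefficients of [q] come from solving the triangular linear system
    [q(z) - q(z + 1) / 2 = (5 + 3 z) f(z) / 16]. *)

(** * Closed forms for the array *)

Lemma psi_closed j : psi j.+4 = (3 * 2 ^ j)%N.
Proof.
elim: j => [|j IH]; first by rewrite psi_rec// unlock.
by rewrite psi_rec// big_nat_recr//= -psi_rec// IH expnS; lia.
Qed.

(** In this order of summation the sum gains its last term when [n] grows,
    which shows that the diagonal doubles. *)
Lemma T_diag_sum n : (4 <= n)%N -> T n n = \sum_(2 <= m < n) T m m.
Proof.
case: n => // n n3; rewrite T_diag_rec// [LHS]big_nat_rev [RHS]big_add1.
by apply: eq_big_nat => k /andP[k0 kn]; congr (T _ _); lia.
Qed.

Lemma T_diag_closed j : T j.+4 j.+4 = 5 * 2 ^+ j.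
Proof.
elim: j => [|j IH]; first by rewrite T_diag_sum// unlock.
by rewrite T_diag_sum// big_nat_recr// -T_diag_sum// IH exprS /=; ring.
Qed.

Lemma T_column j m : (0 < j)%N -> T (j + m) j = T j j + (m * psi j)%:Z.
Proof.
move=> j0; elim: m => [|m IH]; first by rewrite addn0 mul0n addr0.
by rewrite addnS T_rec ?IH//=; lia.
Qed.

Lemma T_closed j z : T (j.+4 + z) j.+4 = (5 + 3 * z%:Z) * 2 ^+ j.
Proof.
have pow2 : (2 ^ j)%N%:Z = 2 ^+ j by rewrite -natz natrX.
by rewrite T_column// T_diag_closed psi_closed !PoszM pow2; ring.
Qed.

(** * The limiting mass function *)

Definition limit_pmf {R : realType} (z : nat) : R :=
  (5 + 3 * z%:R) / 2 ^+ (z + 4).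

Lemma limit_pmf_ge0 {R : realType} z : 0 <= limit_pmf z :> R.
Proof. by rewrite divr_ge0 ?addr_ge0 ?mulr_ge0 ?exprn_ge0. Qed.

(** The factor [2 ^ (n - z - 4)] of the array cancels against the
    normalisation, which removes [n] from the formula. *)
Lemma normT_limit (R : realType) n z : (z + 4 <= n)%N ->
  normT R n (n - z) = limit_pmf z.
Proof.
move=> zn; have -> : n = ((n - z - 4).+4 + z)%N by lia.
set j := (n - z - 4)%N; rewrite addnK /normT T_closed /limit_pmf.
(* Splits the exponent into the factor of the array and that of the limit. *)
have -> : (j.+4 + z = j + (z + 4))%N by lia.
rewrite !(rmorphM, rmorphD, rmorphXn) /= exprD -!pmulrn; field.
by rewrite !expf_neq0.
Qed.

Lemma normT_last (R : realType) n : normT R n n.+1 = 2 ^- n.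
Proof. by rewrite /normT T_last mulr1. Qed.

(** * Polynomials are negligible against powers of two *)

(** The number [(n + k) ^_ k = k! * 'C(n + k, k)] lies in between: this falling
    factorial has [k] factors, the least of which is [n + 1], and a binomial
    coefficient on [n + k] is at most [2 ^ (n + k)]. *)
Lemma leq_exp_fact_pow2 k n : (n.+1 ^ k <= k`! * 2 ^ (n + k))%N.
Proof.
have le_bin m i : ('C(m, i) <= 2 ^ m)%N.
  elim: m i => [|m IH] [|i]; rewrite ?bin0 ?expn_gt0// binS expnS mul2n -addnn.
  by rewrite leq_add.
apply: (@leq_trans ((n + k) ^_ k)); last first.
  by rewrite -bin_ffact mulnC leq_mul2l le_bin orbT.
elim: k => [|k IH]; first by rewrite expn0 ffactn0.
by rewrite addnS ffactSS expnS leq_mul// ltnS leq_addr.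
Qed.

(** The previous bound at exponent [k + 1] leaves a spare factor [n + 1], which
    makes the quotient at most a constant times [1 / (n + 1)]. *)
Lemma cvg_monomial_pow2 (R : realType) k :
  (fun n => n%:R ^+ k / 2 ^+ n : R) @ \oo --> (0 : R).
Proof.
pose c : R := (k.+1`! * 2 ^ k.+1)%:R.
apply: (@squeeze_cvgr _ _ _ _ (fun=> 0) (fun n => c * harmonic n)).
- apply: nearW => n; rewrite divr_ge0 ?exprn_ge0//=.
  rewrite ler_pdivrMr ?exprn_gt0// mulrAC ler_pdivlMr//.
  rewrite /c -!natrX -!natrM ler_nat.
  apply: leq_trans (_ : n.+1 ^ k.+1 <= _)%N.
    by rewrite expnSr leq_mul//; case: (k) => // i; rewrite leq_exp2r.
  by apply: leq_trans (leq_exp_fact_pow2 _ _) _; rewrite expnD; lia.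
- exact: cvg_cst.
- by rewrite -[X in _ --> X](mulr0 c); apply: cvgMl_tmp; exact: cvg_harmonic.
Qed.

Lemma cvg_poly_pow2 (R : realType) (q : {poly R}) :
  (fun n => q.[n%:R] / 2 ^+ n) @ \oo --> (0 : R).
Proof.
have -> : (fun n => q.[n%:R] / 2 ^+ n) =
    (fun n => \sum_(i < size q) q`_i * (n%:R ^+ i / 2 ^+ n)).
  apply/funext => n; rewrite horner_coef mulr_suml.
  by under eq_bigr do rewrite -mulrA.
rewrite [X in _ --> X](_ : 0 = \sum_(i < size q) q`_i * 0); last first.
  by rewrite big1// => i _; rewrite mulr0.
apply: cvg_big => [|i _]; first exact: add_continuous.
by apply: cvgMl_tmp; exact: cvg_monomial_pow2.
Qed.

(** * The limiting random variable *)

(** A countable mixture of point masses, for which integrals are series by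
    linearity in the measure. *)
Definition limit_law {R : realType} : set nat -> \bar R :=
  mseries (fun z => mscale (NngNum (@limit_pmf_ge0 R z)) \d_z) 0.

HB.instance Definition _ (R : realType) := Measure.on (@limit_law R).

(** The partial sums are [q(0) - q(n) / 2 ^ n], and the correction vanishes. *)
Lemma integral_limit_law (R : realType) (f : nat -> R) (q : {poly R}) :
  (forall z, 0 <= f z) ->
  (forall z, limit_pmf z * f z =
     q.[z%:R] / 2 ^+ z - q.[z.+1%:R] / 2 ^+ z.+1) ->
  (\int[limit_law]_z (f z)%:E = (q.[0])%:E)%E.
Proof.
move=> f0 tele; rewrite ge0_integral_measure_series//=; last first.
  by move=> z _; rewrite lee_fin.
set u := (X in limn X).
have {u} -> : u = EFin \o (fun n => q.[0] - q.[n%:R] / 2 ^+ n).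
  apply/funext => n; rewrite /u /=.
  rewrite (eq_bigr (fun z => (limit_pmf z * f z)%:E)) => [|z _].
    rewrite sumEFin.
    rewrite (@telescope_sumr_eq _ _ _ (fun z => - (q.[z%:R] / 2 ^+ z)))//.
      by rewrite opprK expr0 divr1 addrC.
    by move=> z _; rewrite tele opprK addrC.
  rewrite ge0_integral_mscale//=; last by move=> k _; rewrite lee_fin.
  by rewrite integral_dirac//= diracT mul1e.
apply/cvg_lim => //; apply: cvg_EFin; first by apply: nearW => n.
rewrite -[X in _ --> X]subr0; apply: cvgB; first exact: cvg_cst.
exact: cvg_poly_pow2.
Qed.

(** The total mass is the integral of the constant 1. *)
Lemma limit_law_setT (R : realType) : @limit_law R setT = 1%E.
Proof.
have /(_ (fun=> 1) ((3 / 8) *: 'X + 1)) := @integral_limit_law R.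
rewrite integral_cst// mul1e !hornerE; apply=> // z.
rewrite !hornerE /limit_pmf exprD !exprS -[z.+1%:R]natr1; field.
by rewrite expf_neq0.
Qed.

HB.instance Definition _ (R : realType) :=
  @Measure_isProbability.Build _ _ R limit_law (@limit_law_setT R).

Lemma limit_law1 (R : realType) z : @limit_law R [set z] = (limit_pmf z)%:E.
Proof.
rewrite /limit_law /mseries /= (@nneseriesD1 _ _ z)//=.
rewrite eseries0 => [|k _ /= kz]; rewrite /mscale/= diracE.
  by rewrite mem_set// mule1 adde0.
by rewrite memNset ?mule0//=; exact/eqP.
Qed.

Definition limit_rv {R : realType} (z : nat) : R := z%:R.

Lemma measurable_limit_rv (R : realType) :
  measurable_fun setT (@limit_rv R).
Proof. by []. Qed.

HB.instance Definition _ (R : realType) :=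
  isMeasurableFun.Build _ _ nat R (@limit_rv R) (@measurable_limit_rv R).

(** * Moments of the limit *)

Lemma expectation_limit_rv (R : realType) :
  ('E_limit_law[@limit_rv R] = (7 / 4)%:E)%E.
Proof.
pose q : {poly R} := (3 / 8) *: 'X^2 + (11 / 8) *: 'X + (7 / 4)%:P.
rewrite expectation.unlock (integral_limit_law _ _ q) => [|z|z].
- by rewrite !hornerE /= !(mulr0, add0r).
- exact: ler0n.
- rewrite !hornerE /limit_pmf exprD !exprS -[z.+1%:R]natr1 /=; field.
  by rewrite expf_neq0.
Qed.

Lemma second_moment_limit_rv (R : realType) :
  ('E_limit_law[fun z => (@limit_rv R z ^+ 2)%R] = (27 / 4)%:E)%E.
Proof.
pose q : {poly R} :=
  (3 / 8) *: 'X^3 + (7 / 4) *: 'X^2 + (37 / 8) *: 'X + (27 / 4)%:P.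
rewrite expectation.unlock (integral_limit_law _ _ q) => [|z|z].
- by rewrite !hornerE /= !(mulr0, add0r).
- exact: sqr_ge0.
- rewrite /limit_rv !hornerE /limit_pmf exprD !exprS -[z.+1%:R]natr1 /=; field.
  by rewrite expf_neq0.
Qed.

(** The definition of the variance is a nonnegative integral, hence also a
    telescoping series; summing it directly spares a proof of square
    integrability. *)
Lemma variance_limit_rv (R : realType) :
  ('V_limit_law[@limit_rv R] = (59 / 16)%:E)%E.
Proof.
pose q : {poly R} :=
  (3 / 8) *: 'X^3 + (7 / 16) *: 'X^2 + (123 / 128) *: 'X + (59 / 16)%:P.
rewrite /variance covariance.unlock expectation_limit_rv /= expectation.unlock.
rewrite (integral_limit_law _ (fun z => (z%:R - 7 / 4) ^+ 2) q) => [|z|z].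
- by rewrite !hornerE /= !(mulr0, add0r).
- exact: sqr_ge0.
- rewrite !hornerE /limit_pmf exprD !exprS -[z.+1%:R]natr1 /=; field.
  by rewrite expf_neq0.
Qed.

(** * Distribution functions *)

Lemma prob_nat_values (R : realType) (d : measure_display)
    (T : measurableType d) (P : probability T R) (Y : {RV P >-> R}) (K : nat) :
  P [set w | exists2 z : nat, (z < K)%N & Y w = z%:R] =
  (\sum_(z < K) P [set w | Y w = z%:R])%E.
Proof.
rewrite (_ : [set w | _] =
  \big[setU/set0]_(z < K) [set w | Y w = z%:R]); last first.
  rewrite -(bigcup_mkord _ (fun z => [set w | Y w = z%:R])).
  by apply/seteqP; split => w [z zK Yz]; exists z.
rewrite (@measure_bigsetU _ _ _ P (fun z => [set w | Y w = z%:R]))//.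
  by move=> z; exact: (measurable_sfunP Y (measurable_set1 z%:R)).
apply/trivIsetP => i j _ _ ij; apply/seteqP; split => // w [/= -> /eqP].
by rewrite eqr_nat (negbTE ij).
Qed.

Lemma natr_le_bound (R : realType) (x : R) :
  exists K : nat, forall z : nat, (z%:R <= x) = (z < K)%N.
Proof.
have [x0|x0] := leP 0 x; last first.
  by exists 0%N => z; apply/negbTE; rewrite -ltNge (lt_le_trans x0).
by exists (Num.truncn x).+1 => z; rewrite ltnS truncn_ge_nat.
Qed.

Lemma cdf_limit_rv (R : realType) (x : R) (K : nat) :
  (forall z : nat, (z%:R <= x) = (z < K)%N) ->
  cdf (limit_rv : {RV limit_law >-> R}) x = (\sum_(z < K) limit_pmf z)%:E.
Proof.
move=> xK; rewrite /cdf /distribution /pushforward.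
rewrite -sumEFin; under eq_bigr do rewrite -limit_law1.
rewrite (_ : _ @^-1` _ =
  [set w : nat | exists2 z : nat, (z < K)%N & limit_rv w = z%:R :> R]).
  rewrite (prob_nat_values _ _ _ _ (limit_rv : {RV limit_law >-> R})).
  apply: eq_bigr => z _; congr (limit_law _); apply/seteqP; split => w /=.
    by move/eqP; rewrite eqr_nat => /eqP.
  by move=> ->.
apply/seteqP; split => w /=; rewrite in_itv/= xK; first by exists w.
by move=> [z zK /eqP]; rewrite eqr_nat => /eqP ->.
Qed.

(** The event [Z n <= x] contains the event [A] that [Z n] is a natural number
    at most [x], and exceeds it only inside [Z n = -1], that is [X n = n + 1].
    The condition on [n] makes every atom of [A] carry its limiting mass. *)
Lemma cdf_Zrv_bounds (R : realType) (d : measure_display)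
    (Omega : measurableType d) (P : probability Omega R) (n : nat)
    (X : {RV P >-> R}) (x : R) (K : nat) :
  (forall omega, exists2 j : nat, (1 <= j <= n.+1)%N & X omega = j%:R) ->
  (forall j : nat, (1 <= j <= n.+1)%N ->
     P [set omega | X omega = j%:R] = (normT R n j)%:E) ->
  (forall z : nat, (z%:R <= x) = (z < K)%N) -> (K + 4 <= n)%N ->
  ((\sum_(z < K) limit_pmf z)%:E <= cdf (Zrv n X : {RV P >-> R}) x
     <= (\sum_(z < K) limit_pmf z + 2 ^- n)%:E)%E.
Proof.
move=> values law xK Kn; set Y : {RV P >-> R} := Zrv n X.
pose A := [set w | exists2 z : nat, (z < K)%N & Y w = z%:R].
have YX w z : (z <= n)%N -> (Y w = z%:R) <-> (X w = (n - z)%:R).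
  move=> zn; have -> : Y w = n%:R - X w by [].
  by rewrite natrB//; split => [<-|->]; rewrite subKr.
have PA : P A = (\sum_(z < K) limit_pmf z)%:E.
  rewrite /A prob_nat_values -sumEFin; apply: eq_bigr => z _.
  have zK := ltn_ord z.
  rewrite -(normT_limit R n z) -?law; [|lia..].
  by congr (P _); apply/seteqP; split => w /=; apply YX; lia.
have mle : measurable (Y @^-1` `]-oo, x]).
  exact: (measurable_sfunP Y (measurable_itv _)).
have mX j : measurable [set w | X w = j%:R].
  exact: (measurable_sfunP X (measurable_set1 j%:R)).
have mA : measurable A.
  rewrite (_ : A = \bigcup_(z in `I_K) [set w | Y w = z%:R])//.
  apply: bigcup_measurable => z _.
  exact: (measurable_sfunP Y (measurable_set1 z%:R)).
rewrite -[cdf Y x]/(P (Y @^-1` `]-oo, x])); apply/andP; split.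
  rewrite -PA; apply: le_measure; rewrite ?inE// => w [z zK Yz].
  by rewrite /= in_itv /= Yz xK.
rewrite EFinD -PA -normT_last -law ?leqnn//.
apply: (@le_trans _ _ (P (A `|` [set w | X w = n.+1%:R]))); last first.
  exact: measureU2.
apply: le_measure; rewrite ?inE//; first exact: measurableU.
move=> w; rewrite /= in_itv /= => Yx.
have [j /andP[j1 jn] Xj] := values w.
have [jn1|jn1] := eqVneq j n.+1; first by right; rewrite /= Xj jn1.
have Yj : Y w = (n - j)%:R by apply/YX; [lia|rewrite Xj; congr _%:R; lia].
by left; exists (n - j)%N => //; rewrite -xK -Yj.
Qed.

Theorem mainTheorem12 (R : realType)
    (d : nat -> measure_display) (Omega : forall n, measurableType (d n))
    (P : forall n, probability (Omega n) R) (X : forall n, {RV (P n) >-> R})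
    (X_values : forall n, (4 <= n)%N -> forall omega : Omega n,
       exists2 j : nat, (1 <= j <= n.+1)%N & X n omega = j%:R)
    (X_law : forall n, (4 <= n)%N -> forall j : nat, (1 <= j <= n.+1)%N ->
       P n [set omega | X n omega = j%:R] = (normT R n j)%:E) :
  exists (d' : measure_display) (Omega' : measurableType d')
         (P' : probability Omega' R) (Z : {RV P' >-> R}),
    P' [set omega | exists z : nat, Z omega = z%:R] = 1%E /\
    (forall z : nat,
       P' [set omega | Z omega = z%:R] = ((5 + 3 * z%:R) / 2 ^+ (z + 4))%:E) /\
    cvg_in_distribution (fun n => Zrv n (X n) : {RV (P n) >-> R}) Z /\
    ('E_P'[Z] = (7 / 4)%:E)%E /\
    ('E_P'[fun omega => (Z omega ^+ 2)%R] = (27 / 4)%:E)%E /\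
    ('V_P'[Z] = (59 / 16)%:E)%E.
Proof.
exists _, nat, limit_law, limit_rv; split.
  rewrite (_ : [set _ | _] = setT) ?probability_setT//.
  by apply/seteqP; split => // z _; exists z.
split.
  move=> z; rewrite -/(limit_pmf z) -limit_law1; congr (limit_law _).
  apply/seteqP; split => w /=; last by move=> ->.
  by move/eqP; rewrite eqr_nat => /eqP.
split; last first.
  split; first exact: expectation_limit_rv.
  split; [exact: second_moment_limit_rv|exact: variance_limit_rv].
move=> x _; have [K xK] := natr_le_bound R x.
rewrite (cdf_limit_rv _ _ _ xK).
apply: (@squeeze_cvge _ _ _ _ (fun=> (\sum_(z < K) limit_pmf z)%:E) _
  (fun n => (\sum_(z < K) limit_pmf z + 2 ^- n)%:E)).
(* [K + 4 <= n] also puts [n] in the range where the law of [X n] is known. *)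
- near=> n; have Kn : (K + 4 <= n)%N by near: n; exact: nbhs_infty_ge.
  by apply: cdf_Zrv_bounds => //; [apply: X_values|apply: X_law]; lia.
- exact: cvg_cst.
- apply: cvg_EFin; first by apply: nearW => n.
  rewrite -[X in _ --> X]addr0; apply: cvgD; first exact: cvg_cst.
  have := cvg_monomial_pow2 R 0.
  by under eq_fun do rewrite expr0 mul1r.
Unshelve. all: by end_near.
Qed.
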